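(* Let $\mathbb B$ be a stochastic set of interval type, $H\in\mathcal P^{\mathbb B}$, $A\in\mathcal V^{\mathbb B}$. Suppose that $(T_n,H^{(n)})$ and $(T_n,A^{(n)})$ are FCSs for $H\in\mathcal P^{\mathbb B}$ and $A\in\mathcal V^{\mathbb B}$ respectively such that $H^{(n)}\in\mathcal L_s(A^{(n)})$ for each $n\in\mathbf N^+$. Then $(T_n,H^{(n)}.A^{(n)})$ is an FCS for $H_\bullet A\in\mathcal V^{\mathbb B}$, and $$H_\bullet A=\Big((H_0A_0)I_{[\![0]\!]}+\sum_{n=1}^{+\infty}(H^{(n)}.A^{(n)})I_{]\!]T_{n-1},T_n]\!]}\Big)\mathfrak I_{\mathbb B},\qquad T_0=0.$$ Furthermore, this expression does not depend on the choice of FCSs: if $(S_n,\widetilde H^{(n)})$ and $(\widetilde S_n,\widetilde A^{(n)})$ are also FCSs for $H\in\mathcal P^{\mathbb B}$ and $A\in\mathcal V^{\mathbb B}$ respectively such that $\widetilde H^{(n)}\in\mathcal L_s(\widetilde A^{(n)})$ for each $n\in\mathbf N^+$, then $H_\bullet A=X$, where $$X=\Big((H_0A_0)I_{[\![0]\!]}+\sum_{n=1}^{+\infty}(\widetilde H^{(n)}.\widetilde A^{(n)})I_{]\!]\widetilde T_{n-1},\widetilde T_n]\!]}\Big)\mathfrak I_{\mathbb B},\qquad \widetilde T_0=0,\quad \widetilde T_n=S_n\wedge\widetilde S_n\ (n\in\mathbf N^+).$$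
   Context: Fix a probability space $(\Omega,\mathcal F,\mathbf P)$ with a filtration $\mathbb F=(\mathcal F_t)_{t\ge0}$ satisfying the usual conditions; $\mathbf R^+=[0,+\infty[$, $\mathbf N^+=\{1,2,\dots\}$. Indistinguishable processes are identified. $[\![S,T]\!]=\{(\omega,t)\in\Omega\times\mathbf R^+:S(\omega)\le t\le T(\omega)\}$, and $[\![S,T[\![$, $]\!]S,T]\!]$ are defined analogously; $[\![0]\!]=\Omega\times\{0\}$. $X^T$ is $X$ stopped at $T$. For sets, $AB=A\cap B$. For $C\subseteq\Omega\times\mathbf R^+$ and a real function $X$ on $\widetilde C\subseteq\Omega\times\mathbf R^+$, $XI_C$ equals $X$ on $C\cap\widetilde C$ and $0$ elsewhere. A stochastic set of interval type $\mathbb B$ is an optional (or predictable) subset of $\Omega\times\mathbf R^+$ such that for some nonnegative random variable $T$ each section $\mathbb B_\omega=\{t:(\omega,t)\in\mathbb B\}$ is nonempty and equal to $[0,T(\omega)[$ or $[0,T(\omega)]$. Here $T$ (the debut of $\mathbb B^c$) is a stopping time. For a class $\mathcal D$ of processes, $\mathcal D^{\mathbb B}$ is the set of real functions $X$ on $\mathbb B$ for which there exist an increasing sequence of stopping times $T_n\uparrow T$ with $\bigcup_n[\![0,T_n]\!]\supseteq\mathbb B$ and $X^{(n)}\in\mathcal D$ with $(XI_{\mathbb B})^{T_n}=(X^{(n)}I_{\mathbb B})^{T_n}$ for all $n$ (equivalently $XI_{\mathbb B[\![0,T_n]\!]}=X^{(n)}I_{\mathbb B[\![0,T_n]\!]}$).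 Then $(T_n,X^{(n)})$ is called an FCS (fundamental coupled sequence) for $X\in\mathcal D^{\mathbb B}$. $X=Y$ for functions on $\mathbb B$ means $XI_{\mathbb B}$ and $YI_{\mathbb B}$ are indistinguishable. $Y\mathfrak I_{\mathbb B}$ denotes the restriction of $Y$ to $\mathbb B$. $\mathcal P$: predictable processes; $\mathcal V$: adapted (càdlàg) processes with finite variation. Classical Stieltjes integral: for $A\in\mathcal V$, $\mathcal L_s(A)$ is the class of predictable $H$ with $\int_{[0,t]}|H_s||dA_s|<+\infty$ for all $t$; $(H.A)_t=\int_{[0,t]}H_s\,dA_s$, which includes the time-$0$ term $H_0A_0$. $\mathbb B$-Stieltjes integral: $H\in\mathcal P^{\mathbb B}$ is $\mathbb B$-integrable with respect to $A\in\mathcal V^{\mathbb B}$, written $H\in\mathcal L_s^{\mathbb B}(A)$, if (1) $\int_{[0,t]}|H_s(\omega)||dA_s(\omega)|<+\infty$ for all $(\omega,t)\in\mathbb B$; and (2) the function $L(\omega,t)=\int_{[0,t]}H_s(\omega)\,dA_s(\omega)$, $(\omega,t)\in\mathbb B$, belongs to $\mathcal V^{\mathbb B}$. Then $H_\bullet A:=L$. (The existence of FCSs as in the hypothesis is equivalent to $H\in\mathcal L_s^{\mathbb B}(A)$, so $H_\bullet A$ is defined.) *)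

(* Defs.v *)
From HB Require Import structures.
From mathcomp Require Import all_boot all_order all_algebra.
From mathcomp Require Import all_classical all_reals all_analysis measurable_realfun.

Set Implicit Arguments.
Unset Strict Implicit.
Unset Printing Implicit Defensive.

Import Order.TTheory GRing.Theory Num.Theory.
Import numFieldNormedType.Exports.

Local Open Scope classical_set_scope.
Local Open Scope ring_scope.

(* Time is [0, +oo[ inside R.  A process, or a real function on a subset of
   Omega x [0, +oo[, is a total function X : Omega * R -> R of which only the
   values on Omega x [0, +oo[, resp. on that subset, are meaningful.
   The function X I_C is the library's restriction X \_ C. *)

Section StieltjesPath.
Context {R : realType}.
Implicit Types (a h f : R -> R) (s t : R).

(* The Lebesgue-Stieltjes measure of f when f is nondecreasing and
   right-continuous on R, and the zero measure otherwise.  Below, for a cadlag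
   of finite variation on [0, t], the fallback is never used. *)
Definition stieltjes_measure f : {measure set (measurableTypeR R) -> \bar R} :=
  match pselect (exists g : cumulative R R, (g : R -> R) = f) with
  | left e => lebesgue_stieltjes_measure (projT1 (cid e))
  | right _ => mzero
  end.

(* The path a stopped at t, with a(s) = 0 for s < 0, so that da has mass a(0)
   at time 0. *)
Definition stopped_path a t s : R := if s < 0 then 0 else a (Num.min s t).

(* The total variation of [stopped_path a t] on ]-oo, s], jump at 0 included. *)
Definition variation_path a t s : R :=
  if s < 0 then 0 else `|a 0| + fine (total_variation 0 (Num.min s t) a).

(* |da|, and the positive and negative parts of da, on ]-oo, t]. *)
Definition var_measure a t := stieltjes_measure (variation_path a t).
Definition pos_measure a t := stieltjes_measure
  (fun s => (variation_path a t s + stopped_path a t s) / 2).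
Definition neg_measure a t := stieltjes_measure
  (fun s => (variation_path a t s - stopped_path a t s) / 2).

(* int_[0,t] |h_s| |da_s| *)
Definition var_integral h a t : \bar R :=
  (\int[var_measure a t]_(s in `[0%R, t]) `|h s|%:E)%E.

(* int_[0,t] h_s da_s *)
Definition path_integral h a t : R :=
  \int[pos_measure a t]_(s in `[0%R, t]) h s
  - \int[neg_measure a t]_(s in `[0%R, t]) h s.

End StieltjesPath.

Section StochasticBasis.
Context {d : measure_display} {Omega : measurableType d} {R : realType}.
Variables (P : probability Omega R) (F : R -> set (set Omega)).
Implicit Types (X Y H A : Omega * R -> R) (B C : set (Omega * R)).
Implicit Types (S T : Omega -> \bar R) (w : Omega) (s t : R).

Definition filtration : Prop :=
  [/\ forall t, 0 <= t -> sigma_algebra setT (F t),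
      forall t, 0 <= t -> F t `<=` measurable
    & forall s t, 0 <= s -> s <= t -> F s `<=` F t].

(* The first condition also makes P complete. *)
Definition usual_conditions : Prop :=
  (forall N, P.-negligible N -> F 0 N) /\
  (forall t, 0 <= t -> \bigcap_(s in [set s | t < s]) F s `<=` F t).

Definition stopping_time T : Prop :=
  (forall w, (0 <= T w)%E) /\
  (forall t, 0 <= t -> F t [set w | (T w <= t%:E)%E]).

Definition adapted X : Prop := forall t, 0 <= t ->
  forall Y : set R, measurable Y -> F t [set w | Y (X (w, t))].

Definition right_cts X : Prop := forall w t, 0 <= t ->
  X (w, s) @[s --> t^'+] --> X (w, t).
Definition left_cts X : Prop := forall w t, 0 < t ->
  X (w, s) @[s --> t^'-] --> X (w, t).
Definition has_left_limits X : Prop := forall w t, 0 < t ->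
  cvg (X (w, s) @[s --> t^'-]).
Definition finite_variation X : Prop := forall w t, 0 <= t ->
  bounded_variation 0 t (fun s => X (w, s)).

Definition time_domain : set (Omega * R) := [set p | 0 <= p.2].

Definition generated_by (G : set (Omega * R -> R)) : set (set (Omega * R)) :=
  <<s time_domain, [set C | exists2 X : Omega * R -> R, G X &
     exists2 Y : set R, measurable Y & C = time_domain `&` X @^-1` Y] >>.

Definition optional_sets := generated_by
  [set X | [/\ adapted X, right_cts X & has_left_limits X]].
Definition predictable_sets := generated_by
  [set X | adapted X /\ left_cts X].

Definition indistinguishable X Y : Prop :=
  {ae P, forall w, forall t, 0 <= t -> X (w, t) = Y (w, t)}.

(* Indistinguishable processes are identified, so classes of processes are
   closed under indistinguishability and pathwise conditions are almost sure. *)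
Definition up_to_indist (D : set (Omega * R -> R)) : set (Omega * R -> R) :=
  [set X | exists2 Y : Omega * R -> R, D Y & indistinguishable X Y].

Definition predictable : set (Omega * R -> R) := up_to_indist
  [set X | forall Y : set R, measurable Y ->
             predictable_sets (time_domain `&` X @^-1` Y)].

Definition fv_processes : set (Omega * R -> R) := up_to_indist
  [set X | [/\ adapted X, right_cts X, has_left_limits X
             & finite_variation X]].

Definition interval_type B : Prop :=
  (optional_sets B \/ predictable_sets B) /\
  exists2 T : Omega -> \bar R, measurable_fun setT T &
    forall w, (0 <= T w)%E /\
      [set t | B (w, t)] !=set0 /\
      ([set t | B (w, t)] = [set t | 0 <= t /\ (t%:E < T w)%E] \/
       [set t | B (w, t)] = [set t | 0 <= t /\ (t%:E <= T w)%E]).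

(* The debut of the complement of B. *)
Definition end_time B w : \bar R :=
  ereal_inf [set t%:E | t in [set t | 0 <= t /\ ~ B (w, t)]].

Definition itv_cc S T : set (Omega * R) :=
  [set p | 0 <= p.2 /\ (S p.1 <= p.2%:E <= T p.1)%E].
Definition itv_oc S T : set (Omega * R) :=
  [set p | 0 <= p.2 /\ (S p.1 < p.2%:E <= T p.1)%E].
Definition time0 : set (Omega * R) := [set p | p.2 = 0].

Definition stopped X T : Omega * R -> R :=
  fun p => X (p.1, fine (Order.min p.2%:E (T p.1))).

Definition eq_on B X Y : Prop := indistinguishable (X \_ B) (Y \_ B).

(* Sequences are indexed by n >= 1; the terms of index 0 are irrelevant. *)
Definition FCS (D : set (Omega * R -> R)) B (T : nat -> Omega -> \bar R)
    (Xn : nat -> Omega * R -> R) X : Prop :=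
  [/\ forall n, (1 <= n)%N -> stopping_time (T n),
      forall w m n, (1 <= m <= n)%N -> (T m w <= T n w)%E,
      forall w, T n w @[n --> \oo] --> end_time B w,
      B `<=` \bigcup_(n in [set n | (1 <= n)%N]) itv_cc (cst 0%E) (T n)
    & forall n, (1 <= n)%N -> D (Xn n) /\
        indistinguishable (stopped (X \_ B) (T n)) (stopped (Xn n \_ B) (T n))].

Definition localized (D : set (Omega * R -> R)) B : set (Omega * R -> R) :=
  [set X | exists (T : nat -> Omega -> \bar R) Xn, FCS D B T Xn X].

(* (H . A)_t(w) = int_[0,t] H_s(w) dA_s(w), which only depends on the values
   of H(w, _) and A(w, _) on [0, t]. *)
Definition stieltjes_integral H A : Omega * R -> R :=
  fun p => path_integral (fun s => H (p.1, s)) (fun s => A (p.1, s)) p.2.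

Definition stieltjes_var_integral H A : Omega * R -> \bar R :=
  fun p => var_integral (fun s => H (p.1, s)) (fun s => A (p.1, s)) p.2.

(* The class L_s(A); only used for A in [fv_processes]. *)
Definition stieltjes_integrable A : set (Omega * R -> R) :=
  [set H | predictable H /\
    {ae P, forall w, forall t, 0 <= t ->
      (stieltjes_var_integral H A (w, t) < +oo)%E}].

Definition B_stieltjes_integral B H A : Omega * R -> R :=
  stieltjes_integral H A \_ B.

(* The class L_s^B(A); only used for A in [localized fv_processes B]. *)
Definition B_stieltjes_integrable B A : set (Omega * R -> R) :=
  [set H | [/\ localized predictable B H,
    {ae P, forall w, forall t, B (w, t) ->
      (stieltjes_var_integral H A (w, t) < +oo)%E}
    & localized fv_processes B (B_stieltjes_integral B H A)]].

Definition from_zero (T : nat -> Omega -> \bar R) : nat -> Omega -> \bar R :=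
  fun n => if n is _.+1 then T n else cst 0%E.

(* (H_0 A_0) I_[[0]] + sum_(n >= 1) (Hn . An) I_]]T_(n-1), T_n]], T_0 = 0;
   at each point at most one term of the series is nonzero. *)
Definition pasted_integral H A (T : nat -> Omega -> \bar R)
    (Hn An : nat -> Omega * R -> R) : Omega * R -> R :=
  fun p => ((fun q => H (q.1, 0) * A (q.1, 0)) \_ time0) p +
    \big[+%R/0]_(1 <= n <oo)
      (stieltjes_integral (Hn n) (An n)
         \_ (itv_oc (from_zero T n.-1) (from_zero T n))) p.

End StochasticBasis.

(* Main.v *)
(* Any two pieces (Hn, An), (H, A) agree up to the time T n, and a pathwise
   Stieltjes integral up to time t depends only on the paths on [0, t].  Hence
   the B-integral coincides on [0, T n] with Hn . An, and both the coupling and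
   the pasting formula follow.  The substance is that H . A is a process of
   finite variation when A is one and H is predictable and integrable:
   - the positive and negative parts of da on ]-oo, t] are the restrictions of
     those on ]-oo, u] for t <= u, so t |-> (H . A)_t is a difference of integrals
     over [0, t] against two fixed measures, hence right-continuous with left
     limits (dominated convergence) and of finite variation;
   - for a right-continuous path the total variation is a supremum over countably
     many grids, so the measures depend measurably on w; as predictable processes
     are progressive, (H . A)_t is F_t-measurable by a monotone class argument;
   - negligible sets belong to F_0, which absorbs the exceptional paths. *)
Require Import Defs.
From HB Require Import structures.
From mathcomp Require Import all_boot all_order all_algebra.
From mathcomp Require Import all_classical all_reals all_analysis.
From mathcomp Require Import measurable_realfun lra.

Set Implicit Arguments.
Unset Strict Implicit.
Unset Printing Implicit Defensive.

Import Order.TTheory GRing.Theory Num.Theory.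
Import numFieldNormedType.Exports.

Local Open Scope classical_set_scope.
Local Open Scope ring_scope.

(** * Lebesgue-Stieltjes measures *)

Section StieltjesMeasure.
Context {R : realType}.
Implicit Types (f g a h : R -> R) (s t u x y : R).

(** Exactly the functions on which [stieltjes_measure] avoids its zero fallback. *)
Definition cdf f := {homo f : x y / x <= y} /\ right_continuous f.

Lemma stieltjes_measureE f : cdf f ->
  exists2 g : cumulative R R, (g : R -> R) = f &
    stieltjes_measure f = lebesgue_stieltjes_measure g.
Proof.
move=> [ndf rcf].
pose g0 := isCumulative.Build R _ R f ndf rcf.
pose g : cumulative R R := HB.pack f g0.
rewrite /stieltjes_measure; case: pselect => [e|[]]; last by exists g.
by exists (projT1 (cid e)) => //; case: (cid e).
Qed.

Lemma stieltjes_measure_itv f x y : cdf f -> x <= y ->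
  stieltjes_measure f `]x, y]%classic = (f y - f x)%:E.
Proof.
move=> /stieltjes_measureE[g <- ->] xy.
rewrite /= /lebesgue_stieltjes_measure /measure_extension.
by rewrite measurable_mu_extE/= ?wlength_itv_bnd//; exact: is_ocitv.
Qed.

(** Half-open intervals have finite mass and generate the Borel sets; the empty one has mass 0 for
    every measure. *)
Lemma stieltjes_measure_unique f
    (mu : {measure set (measurableTypeR R) -> \bar R}) :
  cdf f -> (forall x y, x < y -> mu `]x, y]%classic = (f y - f x)%:E) ->
  forall A : set (measurableTypeR R), measurable A ->
    stieltjes_measure f A = mu A.
Proof.
move=> cf muE A mA; have [g gf E] := stieltjes_measureE cf.
rewrite E; apply: lebesgue_stieltjes_measure_unique => //.
move=> X /ocitvP[->|[[x y] /= xy ->]].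
  by rewrite !measure0.
rewrite muE// -gf.
rewrite /= /lebesgue_stieltjes_measure /measure_extension.
rewrite measurable_mu_extE/= ?wlength_itv_bnd//; first exact: ltW.
exact: is_ocitv.
Qed.

(* Clamping from below at -1 rather than at 0 keeps the atom at 0 of the
   measures considered, whose functions vanish on the negative half-line. *)
Lemma stieltjes_measure_clamp f g t : cdf f -> cdf g -> -1 <= t ->
  (forall s, g s = f (Num.min (Num.max s (-1)) t)) ->
  forall A : set (measurableTypeR R), measurable A ->
    stieltjes_measure g A = stieltjes_measure f (A `&` `]-1, t]%classic).
Proof.
move=> cf cg t1 gE A mA.
have mD : measurable (`]-1, t]%classic : set (measurableTypeR R)).
  exact: measurable_itv.
rewrite (stieltjes_measure_unique (mu := mrestr (stieltjes_measure f) mD))//.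
move=> x y xy.
rewrite [LHS](_ : _ =
  stieltjes_measure f (`]x, y]%classic `&` `]-1, t]%classic))//.
have -> : `]x, y]%classic `&` `]-1, t]%classic =
    `]Num.max x (-1), Num.min y t]%classic.
  apply/seteqP; split => z /=; rewrite !in_itv/= gt_max le_min.
    by move=> [/andP[-> ->] /andP[-> ->]].
  by move=> /andP[/andP[-> ->] /andP[-> ->]].
have [le|gt] := leP (Num.max x (-1)) (Num.min y t).
  rewrite stieltjes_measure_itv// !gE; move: le.
  rewrite le_min !ge_max => /andP[/andP[_ y1] /andP[xt _]].
  by rewrite (max_idPl y1) (min_idPl (_ : Num.max x (-1) <= t))// ge_max xt.
(* The intersection is empty: [x] and [y] lie both below -1 or both above [t], so clamping gives [g]
   the same value at the two points. *)
rewrite set_itv_ge ?measure0// ?bnd_simp -?leNgt; last exact: ltW.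
rewrite !gE; move: gt; rewrite gt_min !lt_max => /orP[/orP[|y1]|/orP[tx|]].
- by rewrite ltNge (ltW xy).
- by rewrite !(max_idPr _) ?subrr// ltW// (lt_trans xy).
- rewrite !(min_idPr _) ?subrr// le_max; first by rewrite (ltW tx).
  by rewrite (ltW (lt_trans tx xy)).
- by rewrite ltNge t1.
Qed.

End StieltjesMeasure.

(** * Paths of finite variation and the measures they define *)

Section Paths.
Context {R : realType}.
Implicit Types (f g a h : R -> R) (s t u x y : R).

Lemma eq_variations x y f g : {in `[x, y], f =1 g} ->
  variations x y f = variations x y g.
Proof.
move=> fg; apply: eq_imagel => s abs; rewrite /variation.
apply: eq_big_nat => k /= ks.
have abk m : (m < (size s).+1)%N -> nth y (x :: s) m \in `[x, y].
  move=> ms; rewrite in_itv/= (itv_partition_nth_ge ms abs).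
  exact: itv_partition_nth_le.
by rewrite /= -[nth y s k]/(nth y (x :: s) k.+1) !fg// abk// ltnS// ltnW.
Qed.

Lemma eq_total_variation x y f g : {in `[x, y], f =1 g} ->
  total_variation x y f = total_variation x y g.
Proof. by rewrite /total_variation => /eq_variations ->. Qed.

Lemma eq_bounded_variation x y f g : {in `[x, y], f =1 g} ->
  bounded_variation x y f -> bounded_variation x y g.
Proof. by rewrite /bounded_variation => /eq_variations ->. Qed.

Section Congruence.
Variables (a a' : R -> R) (t : R).
Hypotheses (t0 : 0 <= t) (aa' : {in `[0, t], a =1 a'}).

Lemma eq_stopped_path : stopped_path a t = stopped_path a' t.
Proof.
apply/funext => s; rewrite /stopped_path; case: ltP => // s0.
by rewrite aa'// in_itv/= le_min s0 t0/= ge_min lexx orbT.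
Qed.

Lemma eq_variation_path : variation_path a t = variation_path a' t.
Proof.
apply/funext => s; rewrite /variation_path; case: ltP => // s0.
rewrite aa' ?in_itv/= ?lexx//; congr (_ + fine _).
apply: eq_total_variation => x; rewrite in_itv/= => /andP[x0].
by rewrite le_min => /andP[_ xt]; rewrite aa'// in_itv/= x0.
Qed.

Lemma eq_path_integral h h' : {in `[0, t], h =1 h'} ->
  path_integral h a t = path_integral h' a' t.
Proof.
move=> hh'; rewrite /path_integral /pos_measure /neg_measure.
rewrite eq_stopped_path eq_variation_path.
by congr (_ - _); apply: eq_Rintegral => s; rewrite inE/= => st; rewrite hh'.
Qed.

Lemma eq_var_integral h h' : {in `[0, t], h =1 h'} ->
  var_integral h a t = var_integral h' a' t.
Proof.
move=> hh'; rewrite /var_integral /var_measure eq_variation_path.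
by apply: eq_integral => s; rewrite inE/= => st; rewrite hh'.
Qed.

End Congruence.

Definition fv_path a := (forall s, 0 <= s -> a x @[x --> s^'+] --> a s) /\
  (forall t, 0 <= t -> bounded_variation 0 t a).

Lemma fv_pathN a : fv_path a -> fv_path (\- a).
Proof.
move=> [rc bv]; split => [s s0|t t0]; first exact: cvgN (rc _ s0).
exact/bounded_variationN/bv.
Qed.

(* [neg_measure] is [pos_measure] of the opposite path, so only the positive part
   is studied. *)
Definition pos_path a t s : R := (variation_path a t s + stopped_path a t s) / 2.

Lemma variation_pathN a : variation_path (\- a) = variation_path a.
Proof.
apply/funext => t; apply/funext => s; rewrite /variation_path.
by rewrite normrN total_variationN.
Qed.

Lemma stopped_pathN a t s : stopped_path (\- a) t s = - stopped_path a t s.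
Proof. by rewrite /stopped_path; case: ltP; rewrite ?oppr0. Qed.

Lemma neg_measureE a t : neg_measure a t = pos_measure (\- a) t.
Proof.
rewrite /neg_measure /pos_measure variation_pathN; congr stieltjes_measure.
by apply/funext => s; rewrite stopped_pathN.
Qed.

Lemma fin_num_tv a t : fv_path a -> 0 <= t ->
  total_variation 0 t a \is a fin_num.
Proof. by move=> [_ bv] t0; apply/bounded_variationP => //; exact: bv. Qed.

(** Total variation is additive over adjacent intervals, and its part over [[x, y]] dominates the
    increment. *)
Lemma le_tv a x y : fv_path a -> 0 <= x -> x <= y ->
  `|a y - a x| <= fine (total_variation 0 y a) - fine (total_variation 0 x a).
Proof.
move=> fa x0 xy; have y0 := le_trans x0 xy.
have := total_variationD a x0 xy => E.
have fx := fin_num_tv fa x0; have fy := fin_num_tv fa y0.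
have fxy : total_variation x y a \is a fin_num.
  by move: fy; rewrite E fin_numD => /andP[].
rewrite E fineD// addrAC subrr add0r -lee_fin fineK//.
exact: total_variation_ge.
Qed.

(** Increments of the total variation dominate those of [a], and the jump at 0 is
    [(|a 0| + a 0) / 2 >= 0]. Right-continuity passes from [a] to its total variation. *)
Lemma cdf_pos_path a t : fv_path a -> 0 <= t -> cdf (pos_path a t).
Proof.
move=> fa t0; have [rc bv] := fa.
have nd x y : 0 <= x -> x <= y -> pos_path a t x <= pos_path a t y.
  move=> x0 xy; rewrite /pos_path /variation_path /stopped_path.
  rewrite !ltNge x0 (le_trans x0 xy)/= ler_pM2r//.
  have := @le_tv a (Num.min x t) (Num.min y t) fa.
  rewrite le_min x0 t0 => /(_ isT).
  have -> : Num.min x t <= Num.min y t.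
    by rewrite le_min !ge_min xy lexx orbT.
  by move=> /(_ isT); rewrite ler_norml; lra.
have p0 x : x < 0 -> pos_path a t x = 0.
  by rewrite /pos_path /variation_path /stopped_path => ->; rewrite addr0 mul0r.
split=> [x y xy|x].
  have [x0|x0] := leP 0 x; first exact: nd.
  rewrite p0//; have [y0|y0] := ltP y 0; first by rewrite p0.
  (* For [x < 0 <= y] the comparison goes through the value at 0, the nonnegative atom there. *)
  apply: le_trans (nd _ _ (lexx 0) y0).
  rewrite /pos_path /variation_path /stopped_path ltxx.
  rewrite (min_idPl t0) total_variationxx addr0 divr_ge0//.
  by rewrite -lerBlDr sub0r -normrN ler_norm.
have [x0|x0] := ltP x 0.
  rewrite p0//; apply: cvg_near_cst; near=> y; apply: p0.
  by near: y; exact: nbhs_right_lt.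
(* From [t] on the function is constant; before [t] the [Num.min] drops out just to the right of
   [x]. *)
have [tx|xt] := leP t x.
  apply: cvg_near_cst; near=> y.
  have xy : x < y by near: y; exact: nbhs_right_gt.
  rewrite /pos_path /variation_path /stopped_path !ltNge x0.
  rewrite (le_trans x0 (ltW xy))/= !(min_idPr _)//.
  exact: le_trans tx (ltW xy).
have lim : (fun y => (`|a 0| + fine (total_variation 0 y a) + a y) / 2) @ x^'+
    --> pos_path a t x.
  rewrite /pos_path /variation_path /stopped_path ltNge x0/= (min_idPl (ltW xt)).
  apply: cvgM; last exact: cvg_cst.
  apply: cvgD; last exact: rc.
  apply: cvgD; first exact: cvg_cst.
  by apply: (total_variation_right_continuous x0 xt); [exact: rc|exact: bv].
apply: cvg_trans lim; apply: near_eq_cvg; near=> y.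
have xy : x < y by near: y; exact: nbhs_right_gt.
have yt : y < t by near: y; exact: nbhs_right_lt.
rewrite /pos_path /variation_path /stopped_path !ltNge.
by rewrite (le_trans x0 (ltW xy))/= (min_idPl (ltW yt)).
Unshelve. all: by end_near. Qed.

Lemma pos_measureE a t : pos_measure a t = stieltjes_measure (pos_path a t).
Proof. by []. Qed.

(** For [s < 0] the clamped point is still negative and both sides vanish; for [s >= 0] the lower
    clamp is idle. *)
Lemma pos_path_clamp a t u s : 0 <= t -> t <= u ->
  pos_path a t s = pos_path a u (Num.min (Num.max s (-1)) t).
Proof.
move=> t0 tu; rewrite /pos_path /variation_path /stopped_path.
rewrite gt_min gt_max (ltNge t) t0 orbF ltrN10 andbT.
case: ltP => // s0; rewrite (max_idPl (_ : -1 <= s)); last first.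
  by rewrite (le_trans _ s0)// lerN10.
by rewrite (min_idPl (_ : Num.min s t <= u))// ge_min tu orbT.
Qed.

Lemma pos_measure_clamp a t u (A : set (measurableTypeR R)) :
  fv_path a -> 0 <= t -> t <= u -> measurable A ->
  pos_measure a t A = pos_measure a u (A `&` `]-1, t]%classic).
Proof.
move=> fa t0 tu mA; rewrite !pos_measureE.
apply: stieltjes_measure_clamp => //; last first.
- by move=> s; exact: pos_path_clamp.
- by rewrite (le_trans _ t0)// lerN10.
- exact: cdf_pos_path.
- by apply: cdf_pos_path => //; exact: le_trans tu.
Qed.

Lemma pos_measure_sub a t u (A : set (measurableTypeR R)) :
  fv_path a -> 0 <= t -> t <= u -> measurable A -> A `<=` `[0, t]%classic ->
  pos_measure a t A = pos_measure a u A.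
Proof.
move=> fa t0 tu mA At; rewrite (pos_measure_clamp fa t0 tu)//.
congr (pos_measure _ _ _); apply: setIidl => x /At/=; rewrite !in_itv/=.
by move=> /andP[x0 ->]; rewrite andbT (lt_le_trans _ x0)// ltrN10.
Qed.

(** All the mass sits on []-1, t]], where it is an increment of [pos_path]. *)
Lemma pos_measure_finite a t : fv_path a -> 0 <= t ->
  (pos_measure a t setT < +oo)%E.
Proof.
move=> fa t0; rewrite (pos_measure_clamp fa t0 (lexx t))// setTI pos_measureE.
rewrite stieltjes_measure_itv ?ltry//; first exact: cdf_pos_path.
by rewrite (le_trans _ t0)// lerN10.
Qed.

(** [variation_path] is the sum of [pos_path] for [a] and for the opposite path; uniqueness carries
    this identity over to the measures. *)
Lemma var_measureE a t (A : set (measurableTypeR R)) :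
  fv_path a -> 0 <= t -> measurable A ->
  var_measure a t A = (pos_measure a t A + pos_measure (\- a)%R t A)%E.
Proof.
move=> fa t0 mA; have cp := cdf_pos_path fa t0.
have cn := cdf_pos_path (fv_pathN fa) t0.
have E : variation_path a t = (pos_path a t \+ pos_path (\- a) t).
  apply/funext => s /=; rewrite /pos_path variation_pathN stopped_pathN; lra.
have cv : cdf (variation_path a t).
  rewrite E; split => [x y xy|x]; first by apply: lerD; [apply cp|apply cn].
  by apply: cvgD; [apply cp|apply cn].
rewrite -measure_addE.
apply: (stieltjes_measure_unique
  (mu := measure_add (pos_measure a t) (pos_measure (\- a) t))) => // x y xy.
rewrite [LHS]measure_addE !pos_measureE !stieltjes_measure_itv ?(ltW xy)//.
by rewrite E -EFinD/= opprD addrACA.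
Qed.

End Paths.

(** * Regularity of the pathwise integral *)

Section RunningIntegral.
Context {R : realType} (mu : {measure set (measurableTypeR R) -> \bar R}).
Variable g : R -> R.
Hypothesis ig : mu.-integrable setT (EFin \o g).
Implicit Types s t u x y : R.

(** Dominated convergence with bound [|g|]: at each point the restricted integrands are eventually
    equal to the limit one. *)
Lemma cvg_Rintegral_set (D : set R) (Dn : (set R)^nat) :
  measurable (D : set (measurableTypeR R)) ->
  (forall n, measurable (Dn n : set (measurableTypeR R))) ->
  (forall x, \forall n \near \oo, (x \in Dn n) = (x \in D)) ->
  \int[mu]_(x in Dn n) g x @[n --> \oo] --> \int[mu]_(x in D) g x.
Proof.
move=> mD mDn DnD; rewrite /Rintegral.
have iD : mu.-integrable D (EFin \o g).
  exact: integrableS ig.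
apply: fine_cvg; rewrite fineK; last exact: integrable_fin_num iD.
under eq_cvg do rewrite integral_mkcond.
rewrite integral_mkcond.
have mg : measurable_fun setT (EFin \o g) by case/integrableP : ig.
apply: (@dominated_cvg _ _ _ mu setT measurableT _ _ (abse \o (EFin \o g))) => //=.
- move=> n; apply: (iffLR (measurable_restrictT (EFin \o g) (mDn n))).
  exact: measurable_funTS.
- move=> x _; apply: cvg_near_cst; near=> n; rewrite !patchE.
  by rewrite (near (DnD x) n).
- exact: integrable_abse.
- by move=> n x _; rewrite patchE; case: ifP => // _; rewrite abse0.
Unshelve. all: by end_near. Qed.

Let I0 u := \int[mu]_(x in `[0, u]) g x.

(** As [v n] tends to [u] from the right, a given point lies in [[0, v n]] eventually exactly when
    it lies in [[0, u]]. *)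
Lemma running_integral_right_cts u : I0 x @[x --> u^'+] --> I0 u.
Proof.
apply/cvg_at_rightP => v [uv vu]; apply: cvg_Rintegral_set => // x.
have [xu|ux] := leP x u.
  near=> n; rewrite !mem_setE !in_itv/= xu.
  by rewrite (le_trans xu (ltW (uv n))).
  near=> n; have vx : v n < x by near: n; exact: (cvgr_lt u).
  by rewrite !mem_setE !in_itv/= !leNgt vx ux.
Unshelve. all: by end_near. Qed.

Lemma running_integral_left_lim u : cvg (I0 x @[x --> u^'-]).
Proof.
(* The left limit leaves out the endpoint [u], where [mu] may have an atom. *)
apply/cvg_ex; exists (\int[mu]_(x in `[0, u[) g x).
apply/cvg_at_leftP => v [uv vu]; apply: cvg_Rintegral_set => // x.
have [xu|ux] := ltP x u.
    near=> n; have xv : x < v n by near: n; exact: (cvgr_gt u).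
    by rewrite !mem_setE !in_itv/= xu (ltW xv).
  near=> n; rewrite !mem_setE !in_itv/= [x < u]ltNge ux/=.
  by rewrite [x <= v n]leNgt (lt_le_trans (uv n) ux).
Unshelve. all: by end_near. Qed.

End RunningIntegral.

(** Write [g] as [|g| - (|g| - g)]: both terms are nonnegative, so their running integrals are
    nondecreasing. *)
Lemma running_integral_bv {R : realType}
  (mu : {measure set (measurableTypeR R) -> \bar R}) (g : R -> R) (t : R) :
  mu.-integrable setT (EFin \o g) -> 0 <= t ->
  bounded_variation 0 t (fun u => \int[mu]_(x in `[0, u]) g x).
Proof.
move=> ig; rewrite le_eqVlt => /predU1P[<-|t0]; first exact: bounded_variationxx.
have mi u : measurable (`[0, u]%classic : set (measurableTypeR R)).
  exact: measurable_itv.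
have nd (f : R -> R) : mu.-integrable setT (EFin \o f) -> (forall x, 0 <= f x) ->
    bounded_variation 0 t (fun u => \int[mu]_(x in `[0, u]) f x).
  move=> iF f0; apply: nondecreasing_bounded_variation => x y _ _ xy.
  have iFS u : mu.-integrable `[0, u]%classic (EFin \o f) by exact: integrableS iF.
  apply: fine_le; [exact: integrable_fin_num|exact: integrable_fin_num|].
  apply: ge0_subset_integral => //.
  - by have /integrableP[] := iFS y.
  - by move=> z _; rewrite lee_fin.
  - by apply: subset_itvl; rewrite bnd_simp.
have iA : mu.-integrable setT (EFin \o (fun x => `|g x|)).
  exact: integrable_abse ig.
have iB : mu.-integrable setT (EFin \o (fun x => `|g x| - g x)).
  exact: (integrableB measurableT iA ig).
have -> : (fun u => \int[mu]_(x in `[0, u]) g x) =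
  (fun u => \int[mu]_(x in `[0, u]) `|g x|) \+
  (\- (fun u => \int[mu]_(x in `[0, u]) (`|g x| - g x))).
  apply/funext => u /=; rewrite RintegralB//; last 2 first.
    exact: integrableS iA.
    exact: integrableS ig.
  by rewrite opprB addrC subrK.
apply: bounded_variationD => //; first exact: nd.
by apply/bounded_variationN/nd => // x; rewrite subr_ge0 ler_norm.
Qed.

(** * The pathwise integral: regularity in the upper limit and value at time 0 *)

Section PathIntegral.
Context {R : realType}.
Implicit Types (f g a h : R -> R) (s t u x y : R).

(** The measure [|da|] is the sum of the positive and negative parts, so it dominates each.
    Extension of [h] by 0 gives an integrand on the whole line, as the running integrals require. *)
Lemma integrable_pos_measure a h t : fv_path a -> 0 <= t ->
  measurable_fun (`[0, t]%classic : set (measurableTypeR R)) h ->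
  (var_integral h a t < +oo)%E ->
  (pos_measure a t).-integrable setT (EFin \o (h \_ `[0, t])).
Proof.
move=> fa t0 mh; rewrite /var_integral => vi.
have mI : measurable (`[0, t]%classic : set (measurableTypeR R)).
  exact: measurable_itv.
have mnh : measurable_fun (`[0, t]%classic : set (measurableTypeR R))
    (fun s => (`|h s|%:E)%E).
  by apply/measurable_EFinP; exact: measurableT_comp.
apply/integrableP; split.
  apply/measurable_EFinP.
  exact: (iffLR (measurable_restrictT h mI)).
have -> : (fun x => (`|(EFin \o (h \_ `[0%R, t])) x|)%E) =
    (fun s => (`|h s|%:E)%E) \_ `[0, t].
  by apply/funext => s; rewrite /= !patchE; case: ifP; rewrite ?normr0.
rewrite -integral_mkcond; apply: le_lt_trans vi.
rewrite [leRHS](eq_measure_integral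
  (measure_add (pos_measure a t) (pos_measure (\- a) t))); last first.
  by move=> A mA _; rewrite [RHS]measure_addE; exact: var_measureE.
rewrite ge0_integral_measure_add//.
by rewrite leeDl// integral_ge0.
Qed.

Lemma var_integralN h a t : var_integral h (\- a) t = var_integral h a t.
Proof. by rewrite /var_integral /var_measure variation_pathN. Qed.

Section Regularity.
Variables (a h : R -> R).
Hypotheses (fa : fv_path a)
  (mh : forall t, 0 <= t ->
    measurable_fun (`[0, t]%classic : set (measurableTypeR R)) h)
  (vi : forall t, 0 <= t -> (var_integral h a t < +oo)%E).

(** The measures in [path_integral h a u] vary with [u]; on [[0, t]] they are replaced by those of
    the horizon [t]. As [L] is defined on the whole line, its limits involve no boundary case. *)
Let path_integral_local t : 0 <= t -> exists L : R -> R,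
  [/\ {in `[0, t], path_integral h a =1 L},
      forall s, L x @[x --> s^'+] --> L s,
      forall s, cvg (L x @[x --> s^'-])
    & bounded_variation 0 t L].
Proof.
move=> t0; have fN := fv_pathN fa.
have ip := integrable_pos_measure fa t0 (mh t0) (vi t0).
have iN : (pos_measure (\- a) t).-integrable setT (EFin \o (h \_ `[0, t])).
  apply: integrable_pos_measure => //; first exact: mh.
  by rewrite var_integralN vi.
have eqI b u : fv_path b -> u \in `[0, t] ->
    \int[pos_measure b u]_(x in `[0, u]) h x =
    \int[pos_measure b t]_(x in `[0, u]) (h \_ `[0, t]) x.
  rewrite in_itv/= => fb /andP[u0 ut]; congr fine.
  rewrite (eq_measure_integral (pos_measure b t)); last first.
    by move=> A mA Au; exact: pos_measure_sub.
  apply: eq_integral => s; rewrite inE/= in_itv/= => /andP[s0 su].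
  by rewrite patchE ifT// inE/= in_itv/= s0 (le_trans su).
pose I b u := \int[pos_measure b t]_(x in `[0, u]) (h \_ `[0, t]) x.
exists (I a \+ (\- (I (\- a)))); split.
- by move=> u ut; rewrite /path_integral neg_measureE !eqI.
- by move=> s; apply: cvgB; exact: running_integral_right_cts.
- by move=> s; apply: is_cvgB; exact: running_integral_left_lim.
- move: (t0); rewrite le_eqVlt => /predU1P[<-|lt0].
    exact: bounded_variationxx.
  apply: bounded_variationD => //; first exact: running_integral_bv.
  by apply/bounded_variationN/running_integral_bv.
Qed.

Lemma path_integral_right_cts t : 0 <= t ->
  path_integral h a x @[x --> t^'+] --> path_integral h a t.
Proof.
(* The horizon [t + 1] leaves room for a right neighbourhood of [t]. *)
move=> t0; have t10 : 0 <= t + 1 by rewrite addr_ge0.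
have tt1 : t < t + 1 by rewrite ltrDl.
have [L [hL rc _ _]] := path_integral_local t10.
rewrite (hL t) ?in_itv/= ?t0 ?(ltW tt1)//.
have lim := rc t; apply: cvg_trans lim.
apply: near_eq_cvg; near=> y.
have ty : t < y by near: y; exact: nbhs_right_gt.
rewrite hL// in_itv/= (le_trans t0 (ltW ty))/=.
by apply/ltW; near: y; exact: nbhs_right_lt.
Unshelve. all: by end_near. Qed.

Lemma path_integral_left_lim t : 0 < t ->
  cvg (path_integral h a x @[x --> t^'-]).
Proof.
move=> t0; have [L [hL _ ll _]] := path_integral_local (ltW t0).
apply/cvg_ex; exists (lim (L x @[x --> t^'-])).
have lim := ll t; apply: cvg_trans lim; apply: near_eq_cvg; near=> y.
rewrite hL// in_itv/=; apply/andP; split.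
  by apply/ltW; near: y; exact: nbhs_left_gt.
by apply/ltW; near: y; exact: nbhs_left_lt.
Unshelve. all: by end_near. Qed.

Lemma path_integral_bv t : 0 <= t ->
  bounded_variation 0 t (path_integral h a).
Proof.
move=> t0; have [L [hL _ _ bv]] := path_integral_local t0.
by apply: eq_bounded_variation bv => x xt; rewrite hL.
Qed.

End Regularity.

(** The two parts of [da] have atoms [(|a 0| + a 0) / 2] and [(|a 0| - a 0) / 2] at 0, whose
    difference is [a 0]. *)
Lemma path_integral0 a h : path_integral h a 0 = h 0 * a 0.
Proof.
(* Only the value at 0 of the integrator matters. *)
wlog fa : a / fv_path a.
  have aa : {in `[0, 0], a =1 cst (a 0)}.
    by move=> s; rewrite in_itv/= -eq_le => /eqP <-.
  move=> /(_ (cst (a 0))) <-; first exact: (eq_path_integral (lexx 0) aa).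
  split=> [s _|t _]; first exact: cvg_cst.
  exact: nondecreasing_bounded_variation.
have m1 : measurable ([set 0] : set (measurableTypeR R)) by exact: measurable_set1.
have I0 b : fv_path b -> \int[pos_measure b 0]_(s in `[0, 0]) h s =
    h 0 * ((`|b 0| + b 0) / 2).
  move=> fb; rewrite set_itv1 /Rintegral.
  rewrite (eq_integral (cst (h 0)%:E)); last first.
    by move=> x; rewrite inE/= => ->.
  rewrite integral_cst// fineM//; last first.
    rewrite ge0_fin_numE//; apply: le_lt_trans (pos_measure_finite fb (lexx 0)).
    by apply: le_measure; rewrite ?inE.
  congr (_ * _); have cb := cdf_pos_path fb (lexx 0).
  suff -> : pos_measure b 0 [set 0] = ((`|b 0| + b 0) / 2)%:E by [].
  (* These intervals shrink to the point 0 and all have the same mass, since [pos_path] vanishes on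
     negative times. *)
  pose J n : set (measurableTypeR R) := `]0 - n.+1%:R^-1, 0]%classic.
  have mJ n : measurable (J n) by exact: measurable_itv.
  have muJ n : pos_measure b 0 (J n) = ((`|b 0| + b 0) / 2)%:E.
    rewrite pos_measureE stieltjes_measure_itv ?sub0r ?oppr_le0 ?invr_ge0//.
    rewrite /pos_path /variation_path /stopped_path.
    rewrite ltxx oppr_lt0 invr_gt0 ltr0n/= minxx total_variationxx.
    by rewrite !addr0 mul0r subr0.
  have J0 : \bigcap_n J n = [set 0] by rewrite set1_bigcap_oc.
  have : (pos_measure b 0 \o J) n @[n --> \oo] --> pos_measure b 0 [set 0].
    rewrite -J0; apply: nonincreasing_cvg_mu => //.
    - by rewrite muJ ltry.
    - by rewrite J0.
    - move=> m n mn; apply/subsetPset; apply: subset_itvr.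
      by rewrite bnd_simp !sub0r lerN2 lef_pV2 ?posrE// ler_nat.
  move=> /cvg_lim <-//; apply/cvg_lim => //.
  by apply: cvg_near_cst; near=> n; rewrite /= muJ.
rewrite /path_integral neg_measureE !I0//; last exact: fv_pathN.
by rewrite /= normrN -mulrBr; congr (_ * _); lra.
Unshelve. all: by end_near. Qed.

End PathIntegral.

(** * Measurability of the pathwise integral *)

Section GridVariation.
Context {R : realType}.
Implicit Types (f : R -> R) (b x y : R).

Definition grid b n k : R := b * k%:R / n.+1%:R.

Definition grid_variation b f n : R :=
  \sum_(k < n.+1) `|f (grid b n k.+1) - f (grid b n k)|.

(* Rounding up to the grid stays on the right of the rounded point, where the
   path is continuous; hence the variation along any partition is the limit of
   the variations along its roundings, each at most the grid variation. *)
Let partial b f n m : R :=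
  \sum_(0 <= k < m) `|f (grid b n k.+1) - f (grid b n k)|.

Let partialB b f n i j : (i <= j)%N ->
  `|f (grid b n j) - f (grid b n i)| <= partial b f n j - partial b f n i.
Proof.
move=> ij; rewrite /partial (big_cat_nat (n := i))//= addrAC subrr add0r.
by rewrite -(telescope_sumr (fun k => f (grid b n k)) ij); exact: ler_norm_sum.
Qed.

(** For [b > 0] and [x >= 0], the index of the first grid point not below [x]. *)
Let round b n x : nat := `|Num.ceil (x / b * n.+1%:R)|%N.

Let roundP b n x : 0 < b -> 0 <= x ->
  x <= grid b n (round b n x) /\ grid b n (round b n x) < x + b / n.+1%:R.
Proof.
move=> b0 x0; rewrite /grid /round; set c := x / b * _.
have c0 : 0 <= c by rewrite mulr_ge0// divr_ge0// ltW.
have xE : x = b * c / n.+1%:R.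
  by rewrite /c mulrA mulfK// mulrCA mulfV ?mulr1// gt_eqF.
have ceq : (`|Num.ceil c|%N)%:R = (Num.ceil c)%:~R :> R.
  by rewrite natr_absz ger0_norm// ceil_ge0 (lt_le_trans _ c0)// ltrN10.
rewrite ceq; have n0 : (0 : R) < n.+1%:R by [].
split; first by rewrite {1}xE ler_pM2r ?invr_gt0// ler_pM2l// ceil_ge.
rewrite {1}xE -mulrDl ltr_pM2r ?invr_gt0// -{3}(mulr1 b) -mulrDr ltr_pM2l//.
by have := ceilB1_lt c; rewrite intrB ltrBlDr.
Qed.

Let round_le b n x y : 0 < b -> 0 <= x -> x <= y -> (round b n x <= round b n y)%N.
Proof.
move=> b0 x0 xy; rewrite /round -lez_nat !gez0_abs; last 2 first.
- rewrite ceil_ge0 (@lt_le_trans _ _ 0) ?ltrN10// mulr_ge0// divr_ge0//.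
    exact: le_trans xy.
  exact: ltW.
- by rewrite ceil_ge0 (@lt_le_trans _ _ 0) ?ltrN10// mulr_ge0// divr_ge0// ltW.
by rewrite le_ceil// ler_pM2r// ler_pM2r ?invr_gt0.
Qed.

Let round0 b n : round b n 0 = 0%N.
Proof. by rewrite /round !mul0r ceil0. Qed.

Let roundb b n : 0 < b -> round b n b = n.+1.
Proof.
move=> b0; rewrite /round mulfV ?gt_eqF// mul1r.
by rewrite -[n.+1%:R]/(n.+1%:~R) intrKceil.
Qed.

(** The grid variation [W] accumulated up to the rounded point is nondecreasing, so its variation
    along any partition is its total increment; its increments dominate those of the rounded
    path. *)
Let variation_round b f n s : 0 < b -> itv_partition 0 b s ->
  variation 0 b (fun x => f (grid b n (round b n x))) s <= grid_variation b f n.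
Proof.
move=> b0 ps; pose W x := partial b f n (round b n x).
have WE : variation 0 b W s = grid_variation b f n.
  rewrite nondecreasing_variation//.
    rewrite /W round0 roundb// /partial [X in _ - X]big_geq// subr0.
    by rewrite big_mkord.
  move=> x y; rewrite !in_itv/= => /andP[x0 _] _ xy.
  rewrite -subr_ge0; apply: le_trans (partialB _ _ _ (round_le n b0 x0 xy)).
  exact: normr_ge0.
rewrite -WE /variation big_nat [leRHS]big_nat ler_sum// => k /= ks.
(* Monotonicity along a partition, applied to the identity, says that successive points are
   ordered. *)
have id_nd : {in `[0, b] &, {homo (@id R) : x y / x <= y}} by [].
have := nondecreasing_fun_itv_partition id_nd ps ks.
have := itv_partition_nth_ge (ltnW (ks : (k.+1 < (size s).+1)%N)) ps.
rewrite /=; move: (nth _ _ _) (nth _ _ _) => x y x0 xy.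
apply: le_trans (partialB _ _ _ (round_le n b0 x0 xy)) _.
exact: ler_norm.
Qed.

(** Induction on the number of cells by additivity; this includes [b = 0], where the grid is not a
    strict partition. *)
Lemma grid_variation_le b f n : 0 <= b ->
  ((grid_variation b f n)%:E <= total_variation 0 b f)%E.
Proof.
move=> b0.
have g0 k : 0 <= grid b n k by rewrite divr_ge0// mulr_ge0.
have gS k : grid b n k <= grid b n k.+1.
  by rewrite ler_pM2r ?invr_gt0// ler_wpM2l// ler_nat.
have gm m : ((\sum_(k < m) `|f (grid b n k.+1) - f (grid b n k)|)%:E
    <= total_variation 0 (grid b n m) f)%E.
  elim: m => [|m IH]; first by rewrite big_ord0 total_variation_ge0.
  rewrite big_ord_recr/= EFinD (total_variationD f (g0 m) (gS m)).
  by rewrite leeD// total_variation_ge.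
by have := gm n.+1; rewrite /grid mulfK.
Qed.

Lemma total_variation_grid b f : 0 <= b ->
  (forall x, 0 <= x -> x < b -> f y @[y --> x^'+] --> f x) ->
  total_variation 0 b f =
  ereal_sup (range (fun n => (grid_variation b f n)%:E)).
Proof.
move=> + rcf; rewrite le_eqVlt => /predU1P[<-|b0].
  have g0 n : grid_variation 0 f n = 0.
    rewrite /grid_variation big1// => k _.
    by rewrite /grid !mul0r subrr normr0.
  rewrite total_variationxx [X in ereal_sup X](_ : _ = [set 0%E]) ?ereal_sup1//.
  apply/seteqP; split => [_ [n _ <-]|_ ->]; first by rewrite g0.
  by exists 0%N; rewrite ?g0.
apply/eqP; rewrite eq_le; apply/andP; split; last first.
  by apply: ge_ereal_sup => _ [n _ <-]; apply: grid_variation_le; exact: ltW.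
apply: ge_ereal_sup => _ [_ [s ps <-] <-].
set S := ereal_sup _.
have SV n : ((grid_variation b f n)%:E <= S)%E by apply: ereal_sup_ubound; exists n.
(* For [S = +oo] nothing is left to prove, and [-oo] cannot bound a real grid variation. *)
case: S SV => [M| |] SV; [|by rewrite leey|by have := SV 0%N].
rewrite lee_fin.
have lim x : 0 <= x -> x <= b -> f (grid b n (round b n x)) @[n --> \oo] --> f x.
  (* Rounding is exact at [b], so right-continuity is called upon only below [b]. *)
  move=> x0; rewrite le_eqVlt => /predU1P[->|xb].
    apply: cvg_near_cst; near=> n; congr f.
    by rewrite roundb// /grid mulfK.
  apply/cvgrPdist_lt => e e0.
  have /cvgrPdist_lt/(_ _ e0) := rcf _ x0 xb.
  rewrite near_withinE => -[d /= d0 dP].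
  near=> n; have [le lt] := roundP n b0 x0.
  have [<-|ne] := eqVneq x (grid b n (round b n x)).
    by rewrite subrr normr0.
  apply: dP; last by rewrite lt_neqAle ne.
  rewrite /= distrC ger0_norm ?subr_ge0// ltrBlDl.
  apply: lt_trans lt _; rewrite ltrD2l.
  rewrite ltr_pdivrMr// mulrC -ltr_pdivrMr//.
  apply: (@lt_trans _ _ n%:R); last by rewrite ltr_nat.
  by near: n; exact: nbhs_infty_gtr.
have : variation 0 b (fun x => f (grid b n (round b n x))) s @[n --> \oo]
    --> variation 0 b f s.
  have lim_nth k : (k < (size s).+1)%N ->
      f (grid b n (round b n (nth b (0 :: s) k))) @[n --> \oo]
      --> f (nth b (0 :: s) k).
    move=> ks; apply: lim; first exact: itv_partition_nth_ge.
    exact: itv_partition_nth_le.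
  rewrite /variation; elim: (size s) lim_nth => [_|m IH lim_nth].
    rewrite big_geq//; apply: cvg_near_cst; near=> n; exact: big_geq.
  rewrite big_nat_recr//=; under eq_fun do rewrite big_nat_recr//=.
  apply: cvgD; first by apply: IH => k km; apply: lim_nth; exact: ltnW.
  by apply: cvg_norm; apply: cvgB; [exact: (lim_nth m.+1)|exact: lim_nth].
move=> cv; apply: (ler_cvg_to cv (cvg_cst M)); near=> n.
by apply: le_trans (variation_round _ _ b0 ps) _; rewrite -lee_fin.
Unshelve. all: by end_near. Qed.

End GridVariation.

(** * Integrals against a measurable family of finite measures *)

Section KernelIntegral.
Context {d : measure_display} {T : measurableType d} {R : realType}.
Variable mu : T -> {measure set (measurableTypeR R) -> \bar R}.
Hypotheses (mu_fin : forall x, (mu x setT < +oo)%E)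
  (mmuT : measurable_fun setT (fun x => mu x setT))
  (mmu : forall s t, measurable_fun setT (fun x => mu x `]s, t]%classic)).

(** Dynkin induction from the half-open intervals; finiteness of [mu x] turns complements into
    differences. *)
Let measurable_mu (B : set (measurableTypeR R)) : measurable B ->
  measurable_fun setT (fun x => mu x B).
Proof.
pose Q (B : set (measurableTypeR R)) := measurable_fun setT (fun x => mu x B).
move=> mB; apply: (@dynkin_induction _ (measurableTypeR R) (@ocitv R) Q) => //.
- exact: ocitvI.
- by move=> _ [[s t] _ <-]; exact: mmu.
- move=> S mS mQ; rewrite /Q (_ : (fun x => _) = (fun x => mu x setT - mu x S)%E).
    exact: emeasurable_funB.
  apply/funext => x; by rewrite -setTD measureD ?setTI//; exact: mu_fin.
- move=> F mF tF mQ; rewrite /Q (_ : (fun x => _) =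
    (fun x => \big[+%E/0%E]_(0 <= i <oo | i \in predT) mu x (F i)))%E.
    by apply: ge0_emeasurable_sum => // n _; exact: mQ.
  by apply/funext => x; rewrite measure_semi_bigcup//; exact: bigcup_measurable.
Qed.

(** The same induction from measurable rectangles, whose sections have mass [mu x B] times an
    indicator. *)
Lemma measurable_kernel_xsection (A : set (T * measurableTypeR R)) :
  measurable A -> measurable_fun setT (fun x => mu x (xsection A x)).
Proof.
pose Q (A : set (T * measurableTypeR R)) :=
  measurable_fun setT (fun x => mu x (xsection A x)).
rewrite measurable_prod_measurableType.
apply: (@dynkin_induction _ _ _ Q).
- exact: measurable_prod_measurableType.
- move=> _ _ [X1 mX1 [X2 mX2 <-]] [Y1 mY1 [Y2 mY2 <-]].
  exists (X1 `&` Y1); first exact: measurableI.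
  by exists (X2 `&` Y2); [exact: measurableI|rewrite setXI].
- rewrite /Q (_ : (fun x => _) = (fun x => mu x setT))//.
  apply/funext => x; congr (mu x _); apply/seteqP; split => // y _.
  by rewrite /xsection/= inE.
- move=> _ [A' mA [B mB <-]]; rewrite /Q.
  rewrite (_ : (fun x => _) = (fun x => mu x B * (\1_A' x)%:E)%E).
    apply: emeasurable_funM; first exact: measurable_mu.
    by apply/measurable_EFinP; exact: measurable_indic.
  apply/funext => x; rewrite indicE; have [xA|xA] := boolP (x \in A').
    by rewrite mule1 in_xsectionX.
  by rewrite mule0 notin_xsectionX// measure0.
- move=> S mS mQ; rewrite /Q.
  rewrite (_ : (fun x => _) = (fun x => mu x setT - mu x (xsection S x))%E).
    exact: emeasurable_funB.
  apply/funext => x; have mSx := measurable_xsection x mS.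
  rewrite -[RHS](_ : mu x (setT `\` xsection S x) = _).
    congr (mu x _); apply/seteqP; split => y; rewrite /xsection/= !inE//=.
    by move=> [_].
  by rewrite measureD ?setTI//; exact: mu_fin.
- move=> F mF tF mQ; rewrite /Q (_ : (fun x => _) = (fun x =>
    \big[+%E/0%E]_(0 <= i <oo | i \in predT) mu x (xsection (F i) x)))%E.
    by apply: ge0_emeasurable_sum => // n _; exact: mQ.
  apply/funext => x; rewrite xsection_bigcup measure_semi_bigcup//.
  - by move=> i; exact: measurable_xsection.
  - apply/trivIsetP => i j _ _ ij; rewrite -subset0 => y [].
    rewrite /xsection/= !inE => Fi Fj.
    have /trivIsetP/(_ i j I I ij) := tF; rewrite -subset0; apply.
    by split; [exact: Fi|exact: Fj].
  - by apply: bigcup_measurable => i _; exact: measurable_xsection.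
Qed.

Import HBNNSimple.

(** Approximation by simple functions treats nonnegative integrands; the general case splits into
    positive and negative parts. *)
Lemma measurable_kernel_integral (k : T * measurableTypeR R -> \bar R) :
  measurable_fun setT k ->
  measurable_fun setT (fun x => \int[mu x]_s k (x, s))%E.
Proof.
move=> mk; under eq_fun do rewrite integralE.
have ge0 (f : T * measurableTypeR R -> \bar R) : (forall z, 0 <= f z)%E ->
    measurable_fun setT f ->
    measurable_fun setT (fun x => \int[mu x]_s f (x, s))%E.
  move=> f0 mf; pose f_ := nnsfun_approx measurableT mf.
  apply: (measurable_fun_xsection_integral f mu f_).
  - by move=> a b ab; exact/nd_nnsfun_approx.
  - by move=> z; exact/cvg_nnsfun_approx.
  - move=> n r; exact: measurable_kernel_xsection.
have int_pos x :
    (\int[mu x]_s (fun y => k (x, y))^\+ s = \int[mu x]_s k^\+ (x, s))%E.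
  by apply: eq_integral => y _; rewrite !funeposE.
have int_neg x :
    (\int[mu x]_s (fun y => k (x, y))^\- s = \int[mu x]_s k^\- (x, s))%E.
  by apply: eq_integral => y _; rewrite !funenegE.
under eq_fun do rewrite int_pos int_neg.
apply: emeasurable_funB.
- by apply: ge0 => //; exact: measurable_funepos.
- by apply: ge0 => //; exact: measurable_funeneg.
Qed.

End KernelIntegral.

(** * Measurable dependence of the pathwise integral on a parameter *)

Section MeasurablePathIntegral.
Context {d : measure_display} {T : measurableType d} {R : realType}.
Implicit Types (a : T -> R -> R) (s t u : R).

Lemma measurable_total_variation a u : 0 <= u -> (forall x, fv_path (a x)) ->
  (forall s, 0 <= s <= u -> measurable_fun setT (fun x => a x s)) ->
  measurable_fun setT (fun x => fine (total_variation 0 u (a x))).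
Proof.
move=> u0 fa ma; apply: measurableT_comp; first exact: fine_measurable.
(* [esups] at index 0 is the supremum over all the grids. *)
have -> : (fun x => total_variation 0 u (a x)) =
    (fun x => esups (fun n => (grid_variation u (a x) n)%:E) 0%N).
  apply/funext => x; rewrite total_variation_grid//; last first.
    by move=> s s0 _; exact: (fa x).1.
  congr ereal_sup; apply/seteqP; split => _ [n _ <-]; exact: imageP.
apply: measurable_fun_esups => n; apply/measurable_EFinP.
apply: measurable_sum => k; apply: measurableT_comp => //.
(* Only grid points up to [u] are evaluated, so no later value of the path enters. *)
have grid_le m : (m <= n.+1)%N -> 0 <= grid u n m <= u.
  move=> mn; rewrite /grid divr_ge0 ?mulr_ge0//=.
  by rewrite ler_pdivrMr// ler_wpM2l// ler_nat.
by apply: measurable_funB; apply: ma; apply: grid_le => //; exact: ltnW.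
Qed.

Lemma measurable_pos_path a t s : 0 <= t -> (forall x, fv_path (a x)) ->
  (forall s, 0 <= s <= t -> measurable_fun setT (fun x => a x s)) ->
  measurable_fun setT (fun x => pos_path (a x) t s).
Proof.
move=> t0 fa ma; rewrite /pos_path /variation_path /stopped_path.
case: ltP => s0; first exact: measurable_cst.
have u0 : 0 <= Num.min s t by rewrite le_min s0.
have ut : Num.min s t <= t by rewrite ge_min lexx orbT.
apply: measurable_funM => //; apply: measurable_funD; last by apply: ma; rewrite u0.
apply: measurable_funD.
  by apply: measurableT_comp => //; apply: ma; rewrite lexx.
apply: measurable_total_variation => // r /andP[r0 ru]; apply: ma.
by rewrite r0 (le_trans ru).
Qed.

(** Measurability is asked at times up to [t] only, so [T] may carry the sigma-algebra of time [t].
    The measures form a kernel because the mass of []r, s]] is an increment of [pos_path]. *)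
Lemma measurable_path_integral a (h : T * measurableTypeR R -> R) t : 0 <= t ->
  (forall x, fv_path (a x)) ->
  (forall s, 0 <= s <= t -> measurable_fun setT (fun x => a x s)) ->
  measurable_fun setT (h \_ (setT `*` `[0, t])) ->
  measurable_fun setT (fun x => path_integral (fun s => h (x, s)) (a x) t).
Proof.
move=> t0 fa ma mh.
have int_pos b : (forall x, fv_path (b x)) ->
    (forall s, 0 <= s <= t -> measurable_fun setT (fun x => b x s)) ->
    measurable_fun setT (fun x => \int[pos_measure (b x) t]_(s in `[0, t]) h (x, s)).
  move=> fb mb; apply: measurableT_comp; first exact: fine_measurable.
  rewrite (_ : (fun x => _) = fun x => (\int[pos_measure (b x) t]_s
      ((h \_ (setT `*` `[0%R, t])) (x, s))%:E)%E); last first.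
    apply/funext => x; rewrite integral_mkcond; apply: eq_integral => s _.
    by rewrite !patchE in_setX in_setT/=; case: ifP.
  have mitv r s : measurable_fun setT
      (fun x => pos_measure (b x) t `]r, s]%classic).
    have [rs|sr] := leP r s; last first.
      rewrite set_itv_ge ?bnd_simp -?leNgt; last exact: ltW.
      under eq_fun do rewrite measure0.
      exact: measurable_cst.
    under eq_fun => x do
      rewrite pos_measureE (stieltjes_measure_itv (cdf_pos_path (fb x) t0) rs).
    by apply/measurable_EFinP; apply: measurable_funB; exact: measurable_pos_path.
  apply: (measurable_kernel_integral (mu := fun x => pos_measure (b x) t)
    _ _ mitv (k := EFin \o (h \_ (setT `*` `[0%R, t])))).
  - by move=> x; exact: pos_measure_finite.
  (* The total mass is that of []-1, t]], which [mitv] covers. *)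
  - rewrite (_ : (fun x => _) = fun x => pos_measure (b x) t `]-1, t]%classic)//.
    by apply/funext => x; rewrite (pos_measure_clamp (fb x) t0 (lexx t))// setTI.
  - exact/measurable_EFinP.
rewrite /path_integral; under eq_fun do rewrite neg_measureE.
apply: measurable_funB; first exact: int_pos.
apply: (int_pos (fun x => \- (a x))) => [x|s st]; first exact: fv_pathN.
by apply: measurable_funN; exact: ma.
Qed.

End MeasurablePathIntegral.

(** * The integral process *)

Section Progressive.
Context {d : measure_display} {Omega : measurableType d} {R : realType}.
Variables (F : R -> set (set Omega)) (hF : filtration F).
Implicit Types (X H : Omega * R -> R) (s t : R).

(** The sample space with the sigma-algebra generated by [F t], which is [F t] itself for [t >= 0];
    adaptedness becomes measurability on this type. *)
Local Notation sigmaF t := (g_sigma_algebraType (F t)).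

Lemma measurable_sigmaF t (A : set (sigmaF t)) : 0 <= t ->
  measurable A = F t A.
Proof.
by move=> t0; rewrite measurable_g_measurableTypeE//; case: hF => + _ _; exact.
Qed.

Lemma adapted_measurable X s t : adapted F X -> 0 <= s <= t ->
  measurable_fun setT (fun w : sigmaF t => X (w, s)).
Proof.
move=> aX /andP[s0 st] _ Y mY; rewrite setTI measurable_sigmaF ?(le_trans s0)//.
by have [_ _ mono] := hF; apply: (mono s t) => //; exact: aX.
Qed.

Local Notation slab t :=
  ((setT `*` `[0, t]) : set (sigmaF t * measurableTypeR R)).

Let measurable_slab t : measurable (slab t).
Proof. by apply: measurableX => //; exact: measurable_itv. Qed.

(* Left continuity makes the value at time s the limit of the values at the
   largest multiples of 1/(n+1) below s. *)
Let left_cts_measurable X t : 0 <= t -> adapted F X -> left_cts X ->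
  measurable_fun (slab t) (X : sigmaF t * measurableTypeR R -> R).
Proof.
move=> t0 aX lX.
pose rho n s : R := (Num.truncn (s * n.+1%:R))%:R / n.+1%:R.
have n0 n : (0 : R) < n.+1%:R by [].
have rho_le n s : 0 <= s -> rho n s <= s < rho n s + n.+1%:R^-1.
  move=> s0; rewrite /rho ler_pdivrMr// -ltrBlDr.
  have /andP[-> lt] := truncn_itv (mulr_ge0 s0 (ltW (n0 n))).
  by rewrite ltrBlDr -[X in _ + X]mul1r -mulrDl ltr_pdivlMr// natr1.
have rho0 n s : 0 <= rho n s by rewrite divr_ge0.
apply: (@measurable_fun_cvg _ (sigmaF t * measurableTypeR R)%type R (slab t)
  (fun n p => X (p.1, rho n p.2)) X); last first.
  move=> [w s] [_ /=]; rewrite in_itv/= => /andP[s0 st].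
  apply/cvgrPdist_lt => e e0.
  (* [left_cts] concerns positive times; at [s = 0] the approximation is exact. *)
  have := s0; rewrite le_eqVlt => /predU1P[<-|lt0s].
    near=> n; rewrite (_ : rho n 0 = 0) ?subrr ?normr0//.
    by rewrite /rho mul0r truncn0 mul0r.
  have /cvgrPdist_lt/(_ _ e0) := lX w s lt0s.
  rewrite near_withinE => -[e1 /= e1_gt0 e1P]; near=> n.
  have /andP[le lt] := rho_le n s s0.
  have [->|ne] := eqVneq (rho n s) s; first by rewrite subrr normr0.
  apply: e1P; last by rewrite lt_neqAle ne.
  rewrite /= ger0_norm ?subr_ge0// ltrBlDl; apply: lt_trans lt _.
  rewrite ltrD2l -[ltRHS]invrK ltf_pV2 ?posrE ?invr_gt0//.
  apply: (@lt_trans _ _ n%:R); last by rewrite ltr_nat.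
  by near: n; exact: nbhs_infty_gtr.
move=> n _ Y mY.
(* On each cell the approximation is the value of [X] at the left endpoint, so the preimage is a
   countable union of rectangles. Cells starting after [t] miss the slab; the values kept are
   [F t]-measurable. *)
rewrite (_ : _ `&` _ = slab t `&` \bigcup_(k in [set k | k%:R / n.+1%:R <= t])
   ([set w | Y (X (w, k%:R / n.+1%:R))] `*`
    `[k%:R / n.+1%:R, k.+1%:R / n.+1%:R[%classic)).
  apply: measurableI => //; apply: bigcup_measurable => k kt.
  apply: measurableX; last exact: measurable_itv.
  have := @adapted_measurable X (k%:R / n.+1%:R) t aX.
  rewrite divr_ge0// => /(_ kt measurableT Y mY).
  by rewrite setTI.
apply/seteqP; split => [[w s] [sl /= Ys]|[w s] [sl /= [k kt [/= Yk]]]].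
  split => //; have := sl.2; rewrite /= in_itv/= => /andP[s0 st].
  have /andP[le lt] := rho_le n s s0.
  exists (Num.truncn (s * n.+1%:R)); first exact: le_trans le st.
  split => //=; rewrite in_itv/= -/(rho n s) le/=.
  by rewrite -natr1 mulrDl mul1r.
have := sl.2; rewrite /= !in_itv/= => /andP[s0 st] /andP[ks sk].
split => //=; rewrite (_ : rho n s = k%:R / n.+1%:R)//.
rewrite /rho; congr (_%:R / _); apply: truncn_def.
by rewrite -ler_pdivrMr// ks -ltr_pdivlMr.
Unshelve. all: by end_near. Qed.

(** Sets with measurable trace on the slab are stable under countable unions and complements in
    [time_domain], and they include the generators given by left-continuous adapted processes. *)
Lemma predictable_progressive H t : 0 <= t ->
  (forall Y : set R, measurable Y ->
     predictable_sets F (@time_domain _ Omega R `&` H @^-1` Y)) ->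
  measurable_fun setT ((H : sigmaF t * measurableTypeR R -> R) \_ (slab t)).
Proof.
move=> t0 pH.
have slabT p : slab t p -> @time_domain _ Omega R p.
  by move=> [_]/=; rewrite in_itv/= => /andP[].
have pS : predictable_sets F `<=` [set C | measurable (slab t `&` C)].
  apply: smallest_sub; last first.
    move=> _ [X [aX lX] [Y mY ->]].
    rewrite /= [Z in measurable Z](_ : _ = slab t `&` (X @^-1` Y)); last first.
      apply/seteqP; split => p; first by move=> [? []].
      by move=> [sp Yp]; split => //; split => //; exact: slabT.
    exact: left_cts_measurable.
  split => [|A mA|G mG]; first by rewrite /= setI0.
  - rewrite /= [Z in measurable Z](_ : _ = slab t `\` (slab t `&` A)).
      exact: measurableD.
    apply/seteqP; split => p.
      by move=> [sp [_ nA]]; split => // -[].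
    move=> [sp nA]; split => //; split; first exact: slabT.
    by move=> Ap; apply: nA.
  - by rewrite /= setI_bigcupr; apply: bigcup_measurable => k _; exact: mG.
suff mH : measurable_fun (slab t) (H : sigmaF t * measurableTypeR R -> R).
  exact: (iffLR (measurable_restrictT _ (@measurable_slab t)) mH).
move=> _ Y mY.
rewrite (_ : _ `&` _ = slab t `&` (@time_domain _ Omega R `&` H @^-1` Y)).
  by apply: (pS); exact: pH.
apply/seteqP; split => p; last by move=> [? []].
by move=> [sp Yp]; split => //; split => //; exact: slabT.
Qed.

End Progressive.

(** * Finite variation of the integral process *)

Section IntegralProcess.
Context {d : measure_display} {Omega : measurableType d} {R : realType}.
Variables (P : probability Omega R) (F : R -> set (set Omega)).
Hypotheses (hF : filtration F) (hPF : usual_conditions P F).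
Implicit Types (X H A : Omega * R -> R) (s t : R).

Lemma stieltjes_integral_ext H A H' A' w t : 0 <= t ->
  (forall s, 0 <= s <= t -> H (w, s) = H' (w, s)) ->
  (forall s, 0 <= s <= t -> A (w, s) = A' (w, s)) ->
  stieltjes_integral H A (w, t) = stieltjes_integral H' A' (w, t).
Proof.
move=> t0 HH AA; apply: (eq_path_integral (a := fun s => A (w, s))) => // s;
  by rewrite in_itv/= => st; rewrite (HH, AA).
Qed.

Lemma stieltjes_var_integral_ext H A H' A' w t : 0 <= t ->
  (forall s, 0 <= s <= t -> H (w, s) = H' (w, s)) ->
  (forall s, 0 <= s <= t -> A (w, s) = A' (w, s)) ->
  stieltjes_var_integral H A (w, t) = stieltjes_var_integral H' A' (w, t).
Proof.
move=> t0 HH AA; apply: (eq_var_integral (a := fun s => A (w, s))) => // s;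
  by rewrite in_itv/= => st; rewrite (HH, AA).
Qed.

Lemma stieltjes_integral_fv H A : fv_processes P F A ->
  stieltjes_integrable P F A H -> fv_processes P F (stieltjes_integral H A).
Proof.
move=> [A' [aA rA lA fA] AA'] [[H' pH HH'] vHA].
have fvA w : fv_path (fun s => A' (w, s)) by split; [exact: rA|exact: fA].
(* The paths on which [A] and [H] coincide with their regular versions and the integral converges
   absolutely. *)
pose G : set Omega := [set w | [/\ forall t, 0 <= t -> A (w, t) = A' (w, t),
  forall t, 0 <= t -> H (w, t) = H' (w, t) &
  forall t, 0 <= t -> (stieltjes_var_integral H A (w, t) < +oo)%E]].
have aeG : {ae P, forall w, G w}.
  by apply: filterS3 AA' HH' vHA => w.
have F0N : F 0 (~` G) by apply: hPF.1.
have FtN t : 0 <= t -> F t (~` G).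
  by move=> t0; have [_ _ mono] := hF; exact: (mono 0 t (lexx 0) t0).
(* The value 0 off [G] makes every path regular, as [fv_processes] demands of its representative. *)
pose Y p := if p.1 \in G then stieltjes_integral H' A' p else 0.
have YE w t : G w -> Y (w, t) = stieltjes_integral H' A' (w, t).
  by move=> Gw; rewrite /Y mem_set.
have Y0 w t : ~ G w -> Y (w, t) = 0 by move=> Gw; rewrite /Y memNset.
have mH w t : 0 <= t -> measurable_fun (`[0, t]%classic : set (measurableTypeR R))
    (fun s => H' (w, s)).
  move=> t0; have mI : measurable (`[0, t]%classic : set (measurableTypeR R)).
    exact: measurable_itv.
  apply: (iffRL (measurable_restrictT _ mI)).
  have := measurable_fun_pair2 (w : g_sigma_algebraType (F t))
    (predictable_progressive hF t0 pH).
  congr (measurable_fun _ _); apply/funext => s.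
  by rewrite !patchE in_setX in_setT.
have vH w : G w -> forall t, 0 <= t ->
    (stieltjes_var_integral H' A' (w, t) < +oo)%E.
  move=> [AAw HHw vw] t t0.
  rewrite -(@stieltjes_var_integral_ext H A)//; first exact: vw.
    by move=> s /andP[s0 _]; exact: HHw.
  by move=> s /andP[s0 _]; exact: AAw.
exists Y; last first.
  apply: filterS aeG => w Gw t t0; rewrite YE//; have [AAw HHw _] := Gw.
  apply: stieltjes_integral_ext => // s /andP[s0 _]; [exact: HHw|exact: AAw].
split.
- move=> t t0 Z mZ; rewrite -(measurable_sigmaF hF)//.
  have mG : measurable (G : set (g_sigma_algebraType (F t))).
    by rewrite -[G]setCK; apply: measurableC; rewrite measurable_sigmaF//; exact: FtN.
  have mI : measurable_fun setT
      (fun w : g_sigma_algebraType (F t) => stieltjes_integral H' A' (w, t)).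
    apply: (@measurable_path_integral _ (g_sigma_algebraType (F t)) R
      (fun w s => A' (w, s)) H' t t0 fvA); last exact: predictable_progressive.
    by move=> s st; exact: adapted_measurable.
  have mY : measurable_fun setT
      (fun w : g_sigma_algebraType (F t) => Y (w, t)).
    have := iffLR (measurable_restrictT _ mG) (measurable_funTS mI).
    by congr (measurable_fun _ _); apply/funext => w; rewrite patchE.
  by have := mY measurableT Z mZ; rewrite setTI.
- move=> w t t0; have [Gw|Gw] := pselect (G w).
    rewrite YE//; under eq_fun do rewrite YE//.
    exact: (path_integral_right_cts (fvA w) (mH w) (vH w Gw) t0).
  by rewrite Y0//; under eq_fun do rewrite Y0//; exact: cvg_cst.
- move=> w t t0; have [Gw|Gw] := pselect (G w).
    under eq_fun do rewrite YE//.
    exact: (path_integral_left_lim (fvA w) (mH w) (vH w Gw) t0).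
  under eq_fun do rewrite Y0//.
  exact: is_cvg_cst.
- move=> w t t0; have [Gw|Gw] := pselect (G w).
    under eq_fun do rewrite YE//.
    exact: (path_integral_bv (fvA w) (mH w) (vH w Gw) t0).
  under eq_fun do rewrite Y0//.
  exact: nondecreasing_bounded_variation.
Qed.

End IntegralProcess.

(** * Fundamental coupled sequences *)

Section Pasting.
Context {d : measure_display} {Omega : measurableType d} {R : realType}.
Variables (P : probability Omega R) (F : R -> set (set Omega)).
Variable B : set (Omega * R).
Hypothesis hB : interval_type F B.
Implicit Types (X H A : Omega * R -> R) (s t : R) (w : Omega).
Implicit Types (T S : nat -> Omega -> \bar R) (Xn Hn An : nat -> Omega * R -> R).

Lemma interval_type_ge0 w t : B (w, t) -> 0 <= t.
Proof.
have [_ [T _ /(_ w)[_ [_ [BE|BE]]]]] := hB => Bwt;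
  by have : [set t | B (w, t)] t by []; rewrite BE => -[].
Qed.

Lemma interval_type_le w s t : B (w, t) -> 0 <= s <= t -> B (w, s).
Proof.
have [_ [T _ /(_ w)[_ [_ BE]]]] := hB => Bwt /andP[s0 st].
have : [set t | B (w, t)] t by [].
suff : [set t | B (w, t)] t -> [set t | B (w, t)] s by apply.
case: BE => -> [_ tT]; split => //.
  by apply: le_lt_trans tT; rewrite lee_fin.
by apply: le_trans tT; rewrite lee_fin.
Qed.

(** At times up to [T n] stopping has no effect, and the countably many exceptional sets merge into
    a single null set. *)
Lemma FCS_agree D T Xn X : FCS P F D B T Xn X ->
  {ae P, forall w, forall n t, (1 <= n)%N -> B (w, t) -> (t%:E <= T n w)%E ->
     X (w, t) = Xn n (w, t)}.
Proof.
move=> [_ _ _ _ XXn].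
have : {ae P, forall w, forall n, (1 <= n)%N -> forall t, 0 <= t ->
    stopped (X \_ B) (T n) (w, t) = stopped (Xn n \_ B) (T n) (w, t)}.
  apply: ae_foralln => n; have [n1|_] := boolP (1 <= n)%N; last first.
    by apply: aeW.
  by apply: filterS (XXn n n1).2 => w + _.
apply: filterS => w eqX n t n1 Bwt tT.
have := eqX n n1 t (interval_type_ge0 Bwt).
by rewrite /stopped /= (min_idPl tT)/= !patchE mem_set.
Qed.

(** Agreement is stated on all of [[0, t]] because the integral at [t] depends on the whole path up
    to [t]; sections of [B] contain that interval. *)
Lemma FCS_pair_agree D D' S S' Hn An H A :
  FCS P F D B S Hn H -> FCS P F D' B S' An A ->
  {ae P, forall w, forall n t, (1 <= n)%N -> B (w, t) ->
     (t%:E <= Order.min (S n w) (S' n w))%E ->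
     forall s, 0 <= s <= t ->
       H (w, s) = Hn n (w, s) /\ A (w, s) = An n (w, s)}.
Proof.
move=> /FCS_agree HHn /FCS_agree AAn.
apply: filterS2 HHn AAn => w HHn AAn n t n1 Bwt.
rewrite le_min => /andP[tS tS'] s /andP[s0 st].
have Bws : B (w, s) by apply: interval_type_le Bwt _; rewrite s0.
by split; [apply: HHn|apply: AAn] => //; [apply: le_trans tS|apply: le_trans tS'];
  rewrite lee_fin.
Qed.

(** Every interval of the series is open at a nonnegative left endpoint, so none contains 0. *)
Lemma pasted_integral0 H A T Hn An w :
  (forall n, (1 <= n)%N -> (0 <= T n w)%E) ->
  pasted_integral H A T Hn An (w, 0) = H (w, 0) * A (w, 0).
Proof.
move=> T0; rewrite /pasted_integral patchE ifT ?inE//=.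
rewrite [X in _ + X](_ : _ = 0) ?addr0//.
apply/cvg_lim => //; apply: cvg_near_cst; near=> n.
rewrite big_nat big1// => k /andP[k1 _]; rewrite patchE memNset// => -[_ /=].
apply/negP; rewrite negb_and -leNgt; apply/orP; left.
case: k k1 => // -[|k] _ /=; first exact: lexx.
exact: T0.
Unshelve. all: by end_near. Qed.

(** The intervals are disjoint, and the one containing [t] has as index the least [N] with
    [t <= T N]. *)
Lemma pasted_integralE H A T Hn An w t : 0 < t ->
  (forall m n, (1 <= m <= n)%N -> (T m w <= T n w)%E) ->
  (exists2 n, (1 <= n)%N & (t%:E <= T n w)%E) ->
  exists n, [/\ (1 <= n)%N, (t%:E <= T n w)%E &
    pasted_integral H A T Hn An (w, t) = stieltjes_integral (Hn n) (An n) (w, t)].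
Proof.
move=> t0 ndT [n0 n01 n0T].
have exn : exists n, (1 <= n)%N && (t%:E <= T n w)%E by exists n0; rewrite n01.
case: (ex_minnP exn) => N /andP[N1 NT] Nmin.
have TN k : (1 <= k < N)%N -> (T k w < t%:E)%E.
  move=> /andP[k1 kN]; rewrite ltNge; apply/negP => tT.
  by have := Nmin k; rewrite k1 tT leqNgt kN => /(_ isT).
have zT k : (1 <= k)%N -> from_zero T k = T k by case: k.
have inN : itv_oc (from_zero T N.-1) (from_zero T N) (w, t).
  split; first exact: ltW.
  (* For [N = 1] the left endpoint is the conventional time 0, below [t] by assumption. *)
  rewrite /= (zT N)// NT andbT; have [N0|N0] := posnP N.-1.
    by rewrite N0 lte_fin.
  by rewrite zT// TN// N0/= prednK.
have notin k : (1 <= k)%N -> k != N ->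
    ~ itv_oc (from_zero T k.-1) (from_zero T k) (w, t).
  move=> k1 kN [_ /= /andP[lt le]]; move: kN; rewrite neq_ltn => /orP[kN|Nk].
    by move: le; rewrite (zT k)// leNgt TN// k1.
  have Nk1 : (N <= k.-1)%N by rewrite -ltnS prednK.
  move: lt; rewrite (zT k.-1) ?(leq_trans N1)// ltNge.
  by rewrite (le_trans NT)// ndT// N1.
exists N; split => //; rewrite /pasted_integral patchE memNset/=; last first.
  by move=> t00; move: t0; rewrite -t00 ltxx.
rewrite add0r; apply/cvg_lim => //; apply: cvg_near_cst; near=> n.
have Nn : (N < n)%N by near: n; exact: nbhs_infty_gt.
rewrite (bigD1_seq N) ?iota_uniq//=; last by rewrite mem_index_iota N1.
rewrite patchE mem_set// big_seq_cond big1 ?addr0// => k.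
rewrite mem_index_iota => /andP[/andP[k1 _] kN].
by rewrite patchE memNset//; exact: notin.
Unshelve. all: by end_near. Qed.

(** Two sequences of times serve both pasting formulas: the first is the case of equal sequences. *)
Lemma eq_pasted_integral D D' S S' Hn An H A :
  FCS P F D B S Hn H -> FCS P F D' B S' An A ->
  eq_on P B (B_stieltjes_integral B H A)
    (pasted_integral H A (fun n w => Order.min (S n w) (S' n w)) Hn An).
Proof.
move=> hS hS'; have [stS ndS _ covS _] := hS; have [stS' ndS' _ covS' _] := hS'.
apply: filterS (FCS_pair_agree hS hS') => w agree t _.
rewrite /B_stieltjes_integral !patchE; case: ifPn => // Bin; rewrite Bin.
have Bwt := set_mem Bin.
have := interval_type_ge0 Bwt; rewrite le_eqVlt => /predU1P[t0|t0].
  rewrite -t0 pasted_integral0; first exact: path_integral0.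
  move=> n n1; rewrite le_min; apply/andP.
  by split; [exact: (stS n n1).1|exact: (stS' n n1).1].
set T := fun n w => Order.min (S n w) (S' n w).
have ndT m n : (1 <= m <= n)%N -> (T m w <= T n w)%E.
  move=> mn; rewrite le_min !ge_min ndS//= ndS'// orbT.
  by [].
have [|n [n1 tT ->]] := pasted_integralE H A Hn An t0 ndT.
  have [m /= m1 [_ /andP[_ tm]]] := covS _ Bwt.
  have [m' /= m1' [_ /andP[_ tm']]] := covS' _ Bwt.
  (* Both sequences are nondecreasing, so the larger index reaches [t] in each. *)
  exists (maxn m m'); first by rewrite leq_max m1.
  rewrite le_min (le_trans tm) ?(le_trans tm')//.
  - by apply: ndS'; rewrite m1' leq_maxr.
  - by apply: ndS; rewrite m1 leq_maxl.
apply: stieltjes_integral_ext; first exact: ltW.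
  by move=> s /(agree n t n1 Bwt tT)[].
by move=> s /(agree n t n1 Bwt tT)[].
Qed.

End Pasting.

Theorem theorem3p3 (d : measure_display) (Omega : measurableType d)
    (R : realType) (P : probability Omega R) (F : R -> set (set Omega))
    (hF : filtration F) (hPF : usual_conditions P F)
    (B : set (Omega * R)) (hB : interval_type F B)
    (H A : Omega * R -> R)
    (hH : localized P F (predictable P F) B H)
    (hA : localized P F (fv_processes P F) B A)
    (T : nat -> Omega -> \bar R) (Hn An : nat -> Omega * R -> R)
    (hHn : FCS P F (predictable P F) B T Hn H)
    (hAn : FCS P F (fv_processes P F) B T An A)
    (hHA : forall n, (1 <= n)%N -> stieltjes_integrable P F (An n) (Hn n)) :
  [/\ B_stieltjes_integrable P F B A H,
      FCS P F (fv_processes P F) B T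
        (fun n => stieltjes_integral (Hn n) (An n))
        (B_stieltjes_integral B H A),
      eq_on P B (B_stieltjes_integral B H A) (pasted_integral H A T Hn An)
    & forall (S S' : nat -> Omega -> \bar R)
             (Hn' An' : nat -> Omega * R -> R),
        FCS P F (predictable P F) B S Hn' H ->
        FCS P F (fv_processes P F) B S' An' A ->
        (forall n, (1 <= n)%N -> stieltjes_integrable P F (An' n) (Hn' n)) ->
        eq_on P B (B_stieltjes_integral B H A)
          (pasted_integral H A (fun n w => Order.min (S n w) (S' n w))
             Hn' An')].
Proof.
have agree := FCS_pair_agree hB hHn hAn.
have fcs : FCS P F (fv_processes P F) B T
    (fun n => stieltjes_integral (Hn n) (An n)) (B_stieltjes_integral B H A).
  have [stT ndT limT covT Hloc] := hHn; have [_ _ _ _ Aloc] := hAn.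
  split => // n n1; split.
    exact: stieltjes_integral_fv (Aloc n n1).1 (hHA n n1).
  apply: filterS agree => w agree t t0; rewrite /stopped/=.
  set u := fine _.
  (* The minimum lies between 0 and the real [t], so [fine] returns the true stopped time. *)
  have uE : u%:E = Order.min t%:E (T n w).
    rewrite fineK// fin_num_abs gee0_abs; first by rewrite gt_min ltry.
    by rewrite le_min lee_fin t0 (stT n n1).1.
  rewrite /B_stieltjes_integral !patchE; case: ifPn => // Bin; rewrite Bin.
  have Bwu := set_mem Bin.
  have u0 := interval_type_ge0 hB Bwu.
  have uT : (u%:E <= Order.min (T n w) (T n w))%E.
    by rewrite minxx uE ge_min lexx orbT.
  apply: stieltjes_integral_ext => // s /(agree n u n1 Bwu uT).
    by case.
  by case.
split => //.
- split => //; last by exists T, (fun n => stieltjes_integral (Hn n) (An n)).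
  (* One null set must serve all [n], since the index is chosen after [w] and [t]. *)
  have vHA : {ae P, forall w, forall n, (1 <= n)%N -> forall t, 0 <= t ->
      (stieltjes_var_integral (Hn n) (An n) (w, t) < +oo)%E}.
    apply: ae_foralln => n; have [n1|_] := boolP (1 <= n)%N; last first.
    by apply: aeW.
    by apply: filterS (hHA n n1).2 => w + _.
  apply: filterS2 agree vHA => w agree vHA t Bwt.
  have [_ _ _ covT _] := hHn.
  have [n /= n1 [_ /andP[_ tT]]] := covT _ Bwt.
  have t0 := interval_type_ge0 hB Bwt.
  have tT2 : (t%:E <= Order.min (T n w) (T n w))%E by rewrite minxx.
  rewrite (@stieltjes_var_integral_ext _ _ _ _ _ (Hn n) (An n))//.
  + exact: vHA.
  + by move=> s /(agree n t n1 Bwt tT2)[].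
  + by move=> s /(agree n t n1 Bwt tT2)[].
- have TT : (fun n w => Order.min (T n w) (T n w)) = T.
    by apply/funext => n; apply/funext => w; exact: minxx.
  by have := eq_pasted_integral hB hHn hAn; rewrite TT.
- by move=> S S' Hn' An' hS hS' _; exact: eq_pasted_integral hS hS'.
Qed.
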